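(* The category $\mathbf{DMGrp}$ of De Morgan groupoids and their homomorphisms is dually equivalent to the category $\mathbf{DMGrpSpec}$ of DMGrp-spaces and spectral frame morphisms.
   Context: A De Morgan algebra is a bounded distributive lattice $\langle A;\wedge,\vee,0,1\rangle$ with a unary operation $-$ such that $a\leq b$ implies $-b\leq -a$, and $--a=a$. A De Morgan groupoid is an algebra $\langle A;\wedge,\vee,-,\cdot,\rightarrow,t,0,1\rangle$ such that $\langle A;\wedge,\vee,-,0,1\rangle$ is a De Morgan algebra and, for all $a,b,c\in A$: $t\cdot a=a$; $a\cdot 0=0\cdot a=0$; $a\cdot(b\vee c)=(a\cdot b)\vee(a\cdot c)$; $(a\vee b)\cdot c=(a\cdot c)\vee(b\cdot c)$; and $a\cdot b\leq c$ iff $a\leq b\rightarrow c$. Homomorphisms preserve $\wedge,\vee,-,\cdot,\rightarrow,t,0,1$. For a topological space $X$, $\Omega(X)$ is the set of compact open subsets of $X$, and the specialization order is: $x\leqslant y$ iff every open set containing $x$ contains $y$. A spectral space is a compact, $T_0$, sober space $X$ such that $\Omega(X)$ is closed under finite intersections and is a basis for $X$ (sober: every completely prime filter of the lattice of open sets is the set of open neighbourhoods of some point). A map $f\colon X\to Y$ of spectral spaces is a spectral map if $f^{-1}[U]\in\Omega(X)$ for each $U\in\Omega(Y)$. A De Morgan spectral space is $\langle X;g,\tau\rangle$ where $\langle X;\tau\rangle$ is a spectral space, $g\colon X\to X$ is an order-inverting involution for $\leqslant$, and $U^*:=\{x\in X:g(x)\notin U\}\in\Omega(X)$ for every $U\in\Omega(X)$.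 For $S\subseteq X^3$ and $U,V\subseteq X$ let $U\circ V=\{z\in X:\exists x,y\,(Sxyz,\ x\in U,\ y\in V)\}$ and $U\rightarrow V=\{x\in X:\forall y,z\,((Sxyz\ \text{and}\ y\in U)\Rightarrow z\in V)\}$. A DMGrp-space is $\langle X;g,S,\Theta,\tau\rangle$, with $S\subseteq X^3$ and $\Theta\subseteq X$, such that: (1) $\langle X;g,\tau\rangle$ is a De Morgan spectral space; (2) $U,V\in\Omega(X)$ implies $U\circ V\in\Omega(X)$ and $U\rightarrow V\in\Omega(X)$; (3) $Sxyz$, $x'\leqslant x$, $y'\leqslant y$, $z\leqslant z'$ imply $Sx'y'z'$; (4) if not $Sxyz$, there are $U,V\in\Omega(X)$ with $x\in U$, $y\in V$, $z\notin U\circ V$; (5) $\Theta\in\Omega(X)$ and for all $y,z$: $y\leqslant z$ iff there is $x\in\Theta$ with $Sxyz$. A spectral frame morphism between DMGrp-spaces $X$ and $X'$ is a function $f\colon X\to X'$ such that: (1) $f$ is a spectral map; (2) $f^{-1}[\Theta']=\Theta$ and $f(g(x))=g(f(x))$; (3) $Sxyz$ implies $S'f(x)f(y)f(z)$; (4) $S'x'y'f(z)$ implies there are $x,y\in X$ with $Sxyz$, $x'\leqslant f(x)$, $y'\leqslant f(y)$; (5) $S'f(x)y'z'$ implies there are $y,z\in X$ with $Sxyz$, $y'\leqslant f(y)$, $f(z)\leqslant z'$. *)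

(* Defs.v *)
From HB Require Import structures.
From mathcomp Require Import all_boot all_order.
From mathcomp Require Import boolp classical_sets topology.
Set Implicit Arguments.
Unset Strict Implicit.
Unset Printing Implicit Defensive.
Import Order.TTheory.
Local Open Scope classical_set_scope.

Record category := Category {
  obj :> Type;
  hom : obj -> obj -> Type;
  idc : forall a, hom a a;
  compc : forall a b c, hom b c -> hom a b -> hom a c;
  compcA : forall a b c d (h : hom c d) (g : hom b c) (f : hom a b),
    compc h (compc g f) = compc (compc h g) f;
  comp1c : forall a b (f : hom a b), compc (idc b) f = f;
  compc1 : forall a b (f : hom a b), compc f (idc a) = f }.
Arguments hom {c} _ _ : rename.
Arguments idc {c} a : rename.
Arguments compc {c a b c0} _ _ : rename.

Definition op_category (C : category) : category :=
  {| obj := obj C;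
     hom := fun a b => @hom C b a;
     idc := fun a => @idc C a;
     compc := fun _ _ _ g f => compc f g;
     compcA := fun _ _ _ _ h g f => esym (compcA f g h);
     comp1c := fun _ _ f => compc1 f;
     compc1 := fun _ _ f => comp1c f |}.

Record functor (C D : category) := Functor {
  fobj :> C -> D;
  fmap : forall a b, hom a b -> hom (fobj a) (fobj b);
  fmap1 : forall a, fmap (idc a) = idc (fobj a);
  fmapD : forall a b c (g : hom b c) (f : hom a b),
    fmap (compc g f) = compc (fmap g) (fmap f) }.

Definition idF (C : category) : functor C C :=
  {| fobj := fun a => a; fmap := fun _ _ f => f;
     fmap1 := fun _ => erefl; fmapD := fun _ _ _ _ _ => erefl |}.

Section functor_composition.
Variables (C D E : category) (G : functor D E) (F : functor C D).

Let fmap_id a : fmap G (fmap F (idc a)) = idc (G (F a)).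
Proof. by rewrite fmap1 fmap1. Qed.

Let fmap_comp a b c (g : hom b c) (f : hom a b) :
  fmap G (fmap F (compc g f)) = compc (fmap G (fmap F g)) (fmap G (fmap F f)).
Proof. by rewrite fmapD fmapD. Qed.

Definition compF : functor C E :=
  {| fobj := fun a => G (F a); fmap := fun _ _ f => fmap G (fmap F f);
     fmap1 := fmap_id; fmapD := fmap_comp |}.

End functor_composition.

Record nat_iso (C D : category) (F G : functor C D) := NatIso {
  eta : forall a, hom (F a) (G a);
  eta_inv : forall a, hom (G a) (F a);
  etaK : forall a, compc (eta_inv a) (eta a) = idc (F a);
  eta_invK : forall a, compc (eta a) (eta_inv a) = idc (G a);
  eta_natural : forall a b (f : hom a b),
    compc (eta b) (fmap F f) = compc (fmap G f) (eta a) }.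

Definition equivalent_categories (C D : category) : Prop :=
  exists (F : functor C D) (G : functor D C),
    inhabited (nat_iso (compF G F) (idF C)) /\
    inhabited (nat_iso (compF F G) (idF D)).

Definition dually_equivalent (C D : category) : Prop :=
  equivalent_categories C (op_category D).

HB.mixin Record TBDistrLattice_isDeMorgan (d : Order.disp_t) T
    of Order.TBDistrLattice d T := {
  dmneg : T -> T;
  dmneg_anti : forall a b : T, (a <= b -> dmneg b <= dmneg a)%O;
  dmnegK : forall a : T, dmneg (dmneg a) = a }.

#[short(type="deMorganType")]
HB.structure Definition DeMorgan d :=
  { T of Order.TBDistrLattice d T & TBDistrLattice_isDeMorgan d T }.

HB.mixin Record DeMorgan_isDMGroupoid (d : Order.disp_t) T
    of DeMorgan d T := {
  dmmul : T -> T -> T;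
  dmimp : T -> T -> T;
  dmt : T;
  dmmul1l : forall a, dmmul dmt a = a;
  dmmul0r : forall a, dmmul a \bot%O = \bot%O;
  dmmul0l : forall a, dmmul \bot%O a = \bot%O;
  dmmulUr : forall a b c,
    dmmul a (b `|` c)%O = (dmmul a b `|` dmmul a c)%O;
  dmmulUl : forall a b c,
    dmmul (a `|` b)%O c = (dmmul a c `|` dmmul b c)%O;
  dmmul_residual : forall a b c : T,
    (dmmul a b <= c)%O <-> (a <= dmimp b c)%O }.

#[short(type="dmGroupoidType")]
HB.structure Definition DMGroupoid d :=
  { T of DeMorgan d T & DeMorgan_isDMGroupoid d T }.

Arguments dmt {d s}.

Record is_dmgrp_hom d d' (A : dmGroupoidType d) (B : dmGroupoidType d')
    (f : A -> B) : Prop := IsDMGrpHom {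
  dmhomI : forall a b, f (a `&` b)%O = (f a `&` f b)%O;
  dmhomU : forall a b, f (a `|` b)%O = (f a `|` f b)%O;
  dmhomN : forall a, f (dmneg a) = dmneg (f a);
  dmhomM : forall a b, f (dmmul a b) = dmmul (f a) (f b);
  dmhom_imp : forall a b, f (dmimp a b) = dmimp (f a) (f b);
  dmhomt : f dmt = dmt;
  dmhom0 : f \bot%O = \bot%O;
  dmhom1 : f \top%O = \top%O }.

Record dmgrp_hom d d' (A : dmGroupoidType d) (B : dmGroupoidType d') :=
  DMGrpHom { dmhom_fun :> A -> B; dmhom_prop : is_dmgrp_hom dmhom_fun }.

Lemma dmgrp_hom_eq d d' (A : dmGroupoidType d) (B : dmGroupoidType d')
    (f g : dmgrp_hom A B) : (forall a, f a = g a) -> f = g.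
Proof.
case: f g => [f fP] [g gP] /= /funext fg; subst g.
by congr DMGrpHom; exact: Prop_irrelevance.
Qed.

Lemma is_dmgrp_hom_id d (A : dmGroupoidType d) : is_dmgrp_hom (@id A).
Proof. by []. Qed.

Lemma is_dmgrp_hom_comp d1 d2 d3 (A : dmGroupoidType d1)
    (B : dmGroupoidType d2) (C : dmGroupoidType d3) (g : B -> C) (f : A -> B) :
  is_dmgrp_hom g -> is_dmgrp_hom f -> is_dmgrp_hom (g \o f).
Proof.
case=> ? ? ? ? ? gt g0 g1 [fI fU fN fM fi ft f0 f1].
split=> * /=; rewrite ?(fI, fU, fN, fM, fi, ft, f0, f1) //.
Qed.

(* The display is a phantom parameter that only controls the printing of order notations, so
   fixing one loses no De Morgan groupoid. *)
Program Definition DMGrp : category :=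
  {| obj := dmGroupoidType (Order.Disp tt tt);
     hom := fun A B => dmgrp_hom A B;
     idc := fun A => DMGrpHom (is_dmgrp_hom_id A);
     compc := fun _ _ _ g f =>
       DMGrpHom (is_dmgrp_hom_comp (dmhom_prop g) (dmhom_prop f)) |}.
Next Obligation. by move=> *; exact: dmgrp_hom_eq. Qed.
Next Obligation. by move=> *; exact: dmgrp_hom_eq. Qed.
Next Obligation. by move=> *; exact: dmgrp_hom_eq. Qed.

Definition compact_open (X : topologicalType) : set (set X) :=
  [set U | compact U /\ open U].

Definition specialization (X : topologicalType) (x y : X) : Prop :=
  forall U : set X, open U -> U x -> U y.

(* The primeness clause applied to the empty family excludes [set0], so such a
   filter is proper. *)
Record completely_prime_filter (X : topologicalType) (F : set (set X)) : Prop :=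
  CompletelyPrimeFilter {
    cpf_open : F `<=` open;
    cpfT : F setT;
    cpfI : forall U V, F U -> F V -> F (U `&` V);
    cpfS : forall U V, open V -> U `<=` V -> F U -> F V;
    cpf_prime : forall G : set (set X), G `<=` open ->
      F (\bigcup_(U in G) U) -> exists2 U, G U & F U }.

Definition sober (X : topologicalType) : Prop :=
  forall F : set (set X), completely_prime_filter F ->
    exists x : X, F = [set U | open_nbhs x U].

(* Compactness of the space is the nullary case of closure under finite
   intersections. *)
Record spectral_space (X : topologicalType) : Prop := SpectralSpace {
  spectral_compact : compact [set: X];
  spectral_T0 : kolmogorov_space X;
  spectral_sober : sober X;
  spectral_setI : forall U V : set X,
    compact_open U -> compact_open V -> compact_open (U `&` V);
  spectral_basis : basis (@compact_open X) }.

Definition spectral_map (X Y : topologicalType) (f : X -> Y) : Prop :=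
  forall U : set Y, compact_open U -> compact_open (f @^-1` U).

Record de_morgan_spectral (X : topologicalType) (g : X -> X) : Prop :=
  DeMorganSpectral {
    dms_spectral : spectral_space X;
    dms_anti : forall x y, specialization x y -> specialization (g y) (g x);
    dms_invol : involutive g;
    dms_star : forall U : set X,
      compact_open U -> compact_open [set x | ~ U (g x)] }.

Section complex_operations.
Variables (X : Type) (S : X -> X -> X -> Prop).

Definition rel_mul (U V : set X) : set X :=
  [set z | exists x y, [/\ S x y z, U x & V y]].

Definition rel_imp (U V : set X) : set X :=
  [set x | forall y z, S x y z /\ U y -> V z].

End complex_operations.

Record is_dmgrp_space (X : topologicalType) (g : X -> X)
    (S : X -> X -> X -> Prop) (Theta : set X) : Prop := IsDMGrpSpace {
  dmsp_spectral : de_morgan_spectral g;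
  dmsp_mul : forall U V, compact_open U -> compact_open V ->
    compact_open (rel_mul S U V);
  dmsp_imp : forall U V, compact_open U -> compact_open V ->
    compact_open (rel_imp S U V);
  dmsp_mono : forall x y z x' y' z', S x y z -> specialization x' x ->
    specialization y' y -> specialization z z' -> S x' y' z';
  dmsp_sep : forall x y z, ~ S x y z ->
    exists U V, [/\ compact_open U, compact_open V, U x, V y &
                    ~ rel_mul S U V z];
  dmsp_Theta : compact_open Theta;
  dmsp_unit : forall y z,
    specialization y z <-> exists2 x, Theta x & S x y z }.

Record dmgrp_space := DMGrpSpace {
  dmsp_top :> topologicalType;
  dmsp_inv : dmsp_top -> dmsp_top;
  dmsp_rel : dmsp_top -> dmsp_top -> dmsp_top -> Prop;
  dmsp_unitset : set dmsp_top;
  dmsp_prop : is_dmgrp_space dmsp_inv dmsp_rel dmsp_unitset }.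

Local Notation "x <=s y" := (specialization x y) (at level 70).

Record is_spectral_frame_morphism (X X' : dmgrp_space) (f : X -> X') : Prop :=
  IsSpectralFrameMorphism {
    sfm_spectral : spectral_map f;
    sfm_unitset : f @^-1` (@dmsp_unitset X') = @dmsp_unitset X;
    sfm_inv : forall x, f (dmsp_inv x) = dmsp_inv (f x);
    sfm_rel : forall x y z, dmsp_rel x y z -> dmsp_rel (f x) (f y) (f z);
    sfm_back_mul : forall x' y' z, dmsp_rel x' y' (f z) ->
      exists x y, [/\ dmsp_rel x y z, x' <=s f x & y' <=s f y];
    sfm_back_imp : forall x y' z', dmsp_rel (f x) y' z' ->
      exists y z, [/\ dmsp_rel x y z, y' <=s f y & f z <=s z'] }.

Record spectral_frame_morphism (X X' : dmgrp_space) := SpectralFrameMorphism {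
  sfm_fun :> X -> X'; sfm_prop : is_spectral_frame_morphism sfm_fun }.

Lemma sfm_eq (X X' : dmgrp_space) (f g : spectral_frame_morphism X X') :
  (forall x, f x = g x) -> f = g.
Proof.
case: f g => [f fP] [g gP] /= /funext fg; subst g.
by congr SpectralFrameMorphism; exact: Prop_irrelevance.
Qed.

Lemma specialization_refl (X : topologicalType) (x : X) : x <=s x.
Proof. by []. Qed.

Lemma specialization_trans (X : topologicalType) (y x z : X) :
  x <=s y -> y <=s z -> x <=s z.
Proof. by move=> xy yz U oU /(xy _ oU) /(yz _ oU). Qed.

Lemma spectral_map_homo (X Y : topologicalType) (f : X -> Y) (x y : X) :
  basis (@compact_open Y) -> spectral_map f -> x <=s y -> f x <=s f y.
Proof.
move=> [_ bY] fS xy U oU Ufx.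
have [V [cV Vfx] VU] := bY (f x) U (open_nbhs_nbhs (conj oU Ufx)).
by apply: VU; exact: (xy _ (proj2 (fS _ cV))).
Qed.

Lemma sfm_homo (X X' : dmgrp_space) (f : X -> X') (x y : X) :
  is_spectral_frame_morphism f -> x <=s y -> f x <=s f y.
Proof.
move=> fP; apply: spectral_map_homo (sfm_spectral fP).
exact: spectral_basis (dms_spectral (dmsp_spectral (dmsp_prop X'))).
Qed.

Lemma is_sfm_id (X : dmgrp_space) : is_spectral_frame_morphism (@id X).
Proof.
split=> //.
- by move=> x y z Sxyz; exists x, y; split.
- by move=> x y z Sxyz; exists y, z; split.
Qed.

Lemma is_sfm_comp (X Y Z : dmgrp_space) (g : Y -> Z) (f : X -> Y) :
  is_spectral_frame_morphism g -> is_spectral_frame_morphism f ->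
  is_spectral_frame_morphism (g \o f).
Proof.
move=> gP fP; split.
- by move=> U /(sfm_spectral gP) /(sfm_spectral fP).
- by rewrite comp_preimage (sfm_unitset gP) (sfm_unitset fP).
- by move=> x /=; rewrite (sfm_inv fP) (sfm_inv gP).
- by move=> x y z /(sfm_rel fP) /(sfm_rel gP).
- move=> x' y' z /(sfm_back_mul gP)[x1 [y1 [/(sfm_back_mul fP)]]].
  move=> [x [y [Sxyz x1x y1y]]] x'x1 y'y1; exists x, y; split=> //=.
  + exact: specialization_trans x'x1 (sfm_homo gP x1x).
  + exact: specialization_trans y'y1 (sfm_homo gP y1y).
- move=> x y' z' /(sfm_back_imp gP)[y1 [z1 [/(sfm_back_imp fP)]]].
  move=> [y [z [Sxyz y1y zz1]]] y'y1 z1z'; exists y, z; split=> //=.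
  + exact: specialization_trans y'y1 (sfm_homo gP y1y).
  + exact: specialization_trans (sfm_homo gP zz1) z1z'.
Qed.

Program Definition DMGrpSpec : category :=
  {| obj := dmgrp_space;
     hom := spectral_frame_morphism;
     idc := fun X => SpectralFrameMorphism (is_sfm_id X);
     compc := fun _ _ _ g f =>
       SpectralFrameMorphism (is_sfm_comp (sfm_prop g) (sfm_prop f)) |}.
Next Obligation. by move=> *; exact: sfm_eq. Qed.
Next Obligation. by move=> *; exact: sfm_eq. Qed.
Next Obligation. by move=> *; exact: sfm_eq. Qed.

(* Main.v *)
(* Priestley-Stone style duality. To a De Morgan groupoid A one associates the
   space of its prime filters, with g P = {a | - a \notin P}, S P Q R iff
   P . Q is included in R, and Theta = {P | t \in P}; to a DMGrp-space one
   associates its algebra of compact open sets. Everything on the algebraic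
   side rests on separating a filter from a disjoint ideal by a prime filter:
   filters F, G with F . G inside a prime filter R enlarge to prime filters
   still multiplying into R, because {a | a . G is not included in R} is an
   ideal when R is prime. On the topological side, compactness is always used
   through a cluster point of a filter of differences of compact open sets. *)
From HB Require Import structures.
From mathcomp Require Import all_boot all_order.
From mathcomp Require Import boolp classical_sets topology.
Require Import Defs.
Set Implicit Arguments.
Unset Strict Implicit.
Unset Printing Implicit Defensive.
Import Order.TTheory.
Local Open Scope order_scope.
Local Open Scope classical_set_scope.

(** * Separation by prime filters *)

Section prime_filters.
Context {d : Order.disp_t} {L : tbDistrLatticeType d}.
Implicit Types (F I P : set L) (a b c : L).

Record lattice_filter F : Prop := LatticeFilter {
  lfilterT : F \top;
  lfilterS : forall a b, a <= b -> F a -> F b;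
  lfilterI : forall a b, F a -> F b -> F (a `&` b)%O }.

Record lattice_ideal I : Prop := LatticeIdeal {
  lideal0 : I \bot;
  lidealS : forall a b, a <= b -> I b -> I a;
  lidealU : forall a b, I a -> I b -> I (a `|` b)%O }.

Record is_prime_filter P : Prop := IsPrimeFilter {
  prime_lfilter : lattice_filter P;
  prime_proper : ~ P \bot;
  prime_join : forall a b, P (a `|` b)%O -> P a \/ P b }.

Lemma lfilter_principal a : lattice_filter [set b | a <= b].
Proof.
split=> [|b c bc ab|b c ab ac] /=; first exact: lex1.
- exact: le_trans ab bc.
- by rewrite lexI; apply/andP.
Qed.

Lemma lideal_principal a : lattice_ideal [set b | b <= a].
Proof.
split=> [|b c bc ca|b c ab ac] /=; first exact: le0x.
- exact: le_trans bc ca.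
- by rewrite leUx; apply/andP.
Qed.

Lemma prime_setC_ideal P : is_prime_filter P -> lattice_ideal (~` P).
Proof.
move=> [[_ PS _] P0 PU]; split=> // [a b ab Pb /(PS _ _ ab)//|a b Pa Pb].
by move/PU => [].
Qed.

Lemma lfilter_adjoin F a : lattice_filter F ->
  lattice_filter [set c | exists2 b, F b & (b `&` a <= c)%O].
Proof.
move=> [FT FS FI]; split; first by exists \top; rewrite ?lex1.
- by move=> b c bc [b' Fb' b'b]; exists b' => //; exact: le_trans bc.
- move=> b c [b' Fb' b'b] [c' Fc' c'c]; exists (b' `&` c')%O; first exact: FI.
  by rewrite lexI (le_trans _ b'b) ?(le_trans _ c'c) // leI2 // ?leIl ?leIr.
Qed.

(** Zorn's lemma gives a maximal filter [M] over [F] that avoids [I]. If [a] and [b] are both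
    outside [M], adjoining either one reaches [I], through [a'] and [b'] in [M]. By distributivity
    the meet of [a'], [b'] and the join of [a] and [b] lies below a join of two members of [I], so
    that join cannot be in [M]. *)
Lemma prime_filter_separation F I : lattice_filter F -> lattice_ideal I ->
  (forall a, F a -> ~ I a) ->
  exists P, [/\ is_prime_filter P, F `<=` P & forall a, P a -> ~ I a].
Proof.
move=> Ff Ii FI; have [I0 IS IU] := Ii.
(* The members of [F] are added to every set to cover the empty chain. *)
pose good M := lattice_filter (F `|` M) /\
  forall a, (F `|` M) a -> ~ I a.
have [|A [[Af AI] Amax]] := @Zorn_bigcup _ good.
  move=> G Ggood Gtot; split; last first.
    by move=> a [/FI//|[X GX Xa]]; apply: (Ggood _ GX).2; right.
  split; first by left; exact: lfilterT.
  - move=> a b ab [Fa|[X GX Xa]]; first by left; exact: lfilterS Fa.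
    have [Fb|Xb] := lfilterS (Ggood _ GX).1 ab (or_intror Xa); first by left.
    by right; exists X.
  - have key X a b : G X -> (F `|` X) a -> (F `|` X) b ->
        (F `|` \bigcup_(X in G) X) (a `&` b)%O.
      move=> GX Xa Xb.
      have [?|?] := lfilterI (Ggood _ GX).1 Xa Xb; first by left.
      by right; exists X.
    move=> a b [Fa|[X GX Xa]] [Fb|[Y GY Yb]].
    + by left; exact: lfilterI.
    + by apply: (key Y) => //; [left|right].
    + by apply: (key X) => //; [right|left].
    + have [XY|YX] := Gtot _ _ GX GY.
      * by apply: (key Y) => //; right => //; exact: XY.
      * by apply: (key X) => //; right => //; exact: YX.
set M := (F `|` A) in Af AI.
(* Maximality: if the filter [N] generated by [M] and [a] avoided [I], it would be [good] and
   strictly larger than [A]. *)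
have Mmax a : ~ M a -> exists2 b, M b & I (b `&` a)%O.
  move=> Ma; apply: contrapT => /forall2NP nI.
  have [MT _ _] := Af.
  pose N := [set c | exists2 b, M b & (b `&` a <= c)%O].
  have Na : N a by exists \top; rewrite // leIr.
  have MN b : M b -> N b by move=> Mb; exists b; rewrite ?leIl.
  have FN : F `|` N = N by apply/setUidPr => b Fb; apply: MN; left.
  apply: (Amax N); last first.
    split; rewrite FN; first exact: lfilter_adjoin.
    by move=> c [b Mb bac] Ic; have [//|] := nI b; apply; exact: IS Ic.
  split; first by move=> b Ab; apply: MN; right.
  by move=> NA; apply: Ma; right; exact: NA.
exists M; split=> //; last by left.
split=> // [/AI//|a b Mab].
apply: contrapT => /not_orP[/Mmax[a' Ma' Ia] /Mmax[b' Mb' Ib]].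
have := IU _ _ Ia Ib; apply: AI.
apply: (lfilterS Af) (lfilterI Af (lfilterI Af Ma' Mb') Mab).
by rewrite meetUr leU2 // leI2 // ?leIl ?leIr.
Qed.

End prime_filters.

(** * The spectral space of prime filters *)

Record prime_filter d (L : tbDistrLatticeType d) := PrimeFilter {
  pf_mem :> L -> Prop;
  pf_prime : is_prime_filter pf_mem }.

(** Classical equality and choice, as the carrier of a topological space must be a choice type. *)
HB.instance Definition _ d (L : tbDistrLatticeType d) :=
  gen_eqMixin (prime_filter L).
HB.instance Definition _ d (L : tbDistrLatticeType d) :=
  gen_choiceMixin (prime_filter L).

Section prime_filter_space.
Context {d : Order.disp_t} {L : tbDistrLatticeType d}.
Implicit Types (P Q : prime_filter L) (a b c : L) (U V : set (prime_filter L)).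

Lemma pf_eq P Q : (forall a, P a <-> Q a) -> P = Q.
Proof.
move: P Q => [P Pp] [Q Qp] /= PQ.
have PQE : P = Q by apply/funext => a; exact/propext.
by subst Q; congr PrimeFilter; exact: Prop_irrelevance.
Qed.

Lemma pfT P : P \top. Proof. exact: lfilterT (prime_lfilter (pf_prime P)). Qed.

Lemma pf0 P : ~ P \bot. Proof. exact: prime_proper (pf_prime P). Qed.

Lemma pfS P a b : a <= b -> P a -> P b.
Proof. exact: lfilterS (prime_lfilter (pf_prime P)) a b. Qed.

Lemma pfI P a b : P (a `&` b)%O <-> P a /\ P b.
Proof.
split=> [Pab|[]]; last exact: lfilterI (prime_lfilter (pf_prime P)) a b.
by split; apply: pfS Pab; rewrite ?leIl ?leIr.
Qed.

Lemma pfU P a b : P (a `|` b)%O <-> P a \/ P b.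
Proof.
split; first exact: prime_join (pf_prime P) a b.
by case; apply: pfS; rewrite ?leUl ?leUr.
Qed.

(** The Stone map. *)
Definition pf_basic a : set (prime_filter L) := [set P | P a].

Definition pf_open U := forall P, U P -> exists2 a, P a & pf_basic a `<=` U.

Lemma pf_openT : pf_open setT.
Proof. by move=> P _; exists \top; first exact: pfT. Qed.

Lemma pf_openI : setI_closed pf_open.
Proof.
move=> U V oU oV P [/oU[a Pa aU] /oV[b Pb bV]]; exists (a `&` b)%O.
  exact/pfI.
by move=> Q /pfI[/aU ? /bV].
Qed.

Lemma pf_open_bigU (I : Type) (f : I -> set (prime_filter L)) :
  (forall i, pf_open (f i)) -> pf_open (\bigcup_i f i).
Proof.
move=> fo P [i _ /fo[a Pa af]]; exists a => //.
by move=> Q /af; exists i.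
Qed.

End prime_filter_space.

HB.instance Definition _ d (L : tbDistrLatticeType d) :=
  isOpenTopological.Build (prime_filter L) pf_openT pf_openI pf_open_bigU.

Section spectral_prime_filters.
Context {d : Order.disp_t} {L : tbDistrLatticeType d}.
Implicit Types (P Q : prime_filter L) (a b c : L) (U V : set (prime_filter L)).

Lemma pf_openE U : open U = pf_open U. Proof. by []. Qed.

Lemma pf_basic_open a : open (pf_basic a).
Proof. by rewrite pf_openE => P Pa; exists a. Qed.

Lemma pf_nbhsP P U : nbhs P U <-> exists2 a, P a & pf_basic a `<=` U.
Proof.
rewrite nbhsE /=; split=> [[V [oV VP] VU]|[a Pa aU]].
  by have [a Pa aV] := oV _ VP; exists a => //; exact: subset_trans VU.
by exists (pf_basic a) => //; split=> //; exact: pf_basic_open.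
Qed.

(** When [a] is not below [b], a prime filter separates the principal filter of [a] from the
    principal ideal of [b]. *)
Lemma pf_basic_sub a b : (pf_basic a `<=` pf_basic b) <-> a <= b.
Proof.
split=> [ab|ab P]; last exact: pfS.
apply: contrapT => nab.
have [|P [Pp aP Pb]] := prime_filter_separation
  (lfilter_principal a) (lideal_principal b).
  by move=> c ac cb; apply: nab; exact: le_trans ac cb.
by apply: (Pb b _ (lexx _)); apply: (ab (PrimeFilter Pp)); apply: aP => /=.
Qed.

Lemma pf_basic_inj : injective (@pf_basic d L).
Proof.
by move=> a b ab; apply/eqP; rewrite eq_le; apply/andP; split;
  apply/pf_basic_sub; rewrite ab.
Qed.

(* A filter on [pf_basic a] clusters at any prime filter containing [a] and
   avoiding the ideal of those [c] whose basic set is null for the filter. *)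
Lemma pf_basic_compact a : compact (pf_basic a).
Proof.
move=> F PF Fa.
have Ii : lattice_ideal [set c | F (~` pf_basic c)].
  split=> [|b c bc|b c Fb Fc] /=.
  - by apply: filterS filterT => P _; exact: pf0.
  - by apply: filterS => P nPc /(pfS bc).
  - by apply: filterS (filterI Fb Fc) => P [nb nc] /pfU[].
(* The first goal is disjointness: a null [b] above [a] would put the empty set in the filter. *)
have [b ab Fb|P [Pp aP PI]] := prime_filter_separation (lfilter_principal a) Ii.
  apply: (@filter_not_empty _ F); apply: filterS (filterI Fa Fb) => P [Pa].
  by apply; exact: pfS Pa.
exists (PrimeFilter Pp); split; first by apply: aP => /=.
move=> B N FB /pf_nbhsP[c Pc cN]; apply: contrapT => BN.
apply: (PI c) => //; apply: filterS FB => Q BQ /cN NQ.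
by apply: BN; exists Q.
Qed.

(** If a compact open [U] is not basic, the differences of [U] with the basic sets inside it
    generate a proper filter, which clusters at some [P] in [U]. But [P] has a basic neighbourhood
    inside [U], and the rest of [U] belongs to that filter. *)
Lemma pf_compact_openP U : compact_open U <-> exists a, U = pf_basic a.
Proof.
split=> [[cU oU]|[a ->]]; last first.
  by split; [exact: pf_basic_compact|exact: pf_basic_open].
apply: contrapT => nU.
pose D := [set a | pf_basic a `<=` U].
have D0 : D \bot by move=> P /pf0.
pose F := filter_from D (fun a => U `\` pf_basic a).
have FF : ProperFilter F.
  apply: filter_from_proper.
    apply: filter_from_filter; first by exists \bot.
    move=> a b Da Db; exists (a `|` b)%O; first by move=> P /pfU[/Da|/Db].
    by move=> P [UP nP]; split; split=> //; apply: contra_not nP => ?;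
      apply/pfU; [left|right].
  move=> a Da; apply: contrapT => nUa; apply: nU; exists a.
  apply/seteqP; split=> // P UP; apply: contrapT => nPa.
  by apply: nUa; exists P.
have FU : F U by exists \bot => //; exact: subDsetl.
have [P [UP clP]] := cU F FF FU.
have [a Pa aU] := oU _ UP.
have Fa : F (U `\` pf_basic a) by exists a.
have Na : nbhs P (pf_basic a) by apply/pf_nbhsP; exists a.
by have [Q [[_ ?]]] := clP _ _ Fa Na.
Qed.

Lemma pf_specialization P Q : specialization P Q <-> pf_mem P `<=` pf_mem Q.
Proof.
split=> [PQ a Pa|PQ U oU /oU[a Pa aU]]; last by apply: aU; exact: PQ.
by apply: (PQ (pf_basic a)) Pa; exact: pf_basic_open.
Qed.

Lemma pf_kolmogorov : kolmogorov_space (prime_filter L).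
Proof.
move=> P Q /eqP PQ.
have [a nPQ] : exists a, ~ (P a <-> Q a).
  apply: contrapT => /forallNP nPQ; apply/PQ/pf_eq.
  by move=> a; have /contrapT := nPQ a.
exists (pf_basic a); rewrite !inE !pf_nbhsP /=.
have [Pa|nPa] := pselect (P a).
  left; split; first by exists a.
  by move=> Qa; exact: nPQ.
right; split; last exact: nPa.
by exists a => //; apply: contrapT => nQa; exact: nPQ.
Qed.

(** The point of [F] consists of the [a] with [pf_basic a] in [F]. Complete primeness is used on
    three covers by basic sets: the empty cover of [pf_basic \bot] gives properness, a two-element
    cover gives primeness, and the cover of an arbitrary open set shows that the point determines
    [F]. *)
Lemma pf_sober : sober (prime_filter L).
Proof.
move=> F [Fo FT FI FS Fp].
have Fbasic (G : set L) U : U = \bigcup_(a in G) pf_basic a -> F U ->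
    exists2 a, G a & F (pf_basic a).
  move=> UG FU.
  have [||_ [a Ga <-] Fa] := Fp (pf_basic @` G); last by exists a.
    by move=> _ [a _ <-]; exact: pf_basic_open.
  by move: FU; rewrite UG bigcup_image.
have Pp : is_prime_filter [set a | F (pf_basic a)].
  split; first split.
  - by apply: FS FT; [exact: pf_basic_open|move=> P _; exact: pfT].
  - move=> a b /pf_basic_sub ab; apply: FS => //; exact: pf_basic_open.
  - move=> a b Fa Fb; apply: FS (FI _ _ Fa Fb); first exact: pf_basic_open.
    by move=> P [Pa Pb]; apply/pfI.
  - move=> F0; have [|//|//] := Fbasic set0 (pf_basic \bot).
    by rewrite bigcup_set0; apply/seteqP; split=> // P /pf0.
  - move=> a b Fab.
    have [|//|c [->|->] ?] := Fbasic [set a; b] (pf_basic (a `|` b)%O).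
    + apply/seteqP; split=> [P /pfU[Pa|Pb]|P [c [->|->] Pc]].
      * by exists a => //; left.
      * by exists b => //; right.
      * by apply/pfU; left.
      * by apply/pfU; right.
    + by left.
    + by right.
exists (PrimeFilter Pp); apply/seteqP; split=> U.
  move=> FU; split; first exact: Fo.
  have [|//|a aU Fa] := Fbasic [set a | pf_basic a `<=` U] U; last exact: aU.
  apply/seteqP; split=> [P UP|P [a aU]]; last exact: aU.
  by have [a Pa aU] := Fo _ FU _ UP; exists a.
by move=> [oU /oU[a Fa aU]]; exact: FS Fa.
Qed.

Lemma pf_basicI a b :
  pf_basic a `&` pf_basic b = pf_basic (a `&` b)%O :> set (prime_filter L).
Proof. by apply/seteqP; split=> P /pfI. Qed.

Lemma pf_spectral : spectral_space (prime_filter L).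
Proof.
split.
- have -> : [set: prime_filter L] = pf_basic \top.
    by apply/seteqP; split=> // P _; exact: pfT.
  exact: pf_basic_compact.
- exact: pf_kolmogorov.
- exact: pf_sober.
- move=> _ _ /pf_compact_openP[a ->] /pf_compact_openP[b ->].
  by rewrite pf_basicI; apply/pf_compact_openP; exists (a `&` b)%O.
- split=> [U [] //|P N /pf_nbhsP[a Pa aN]].
  exists (pf_basic a) => //; split=> //.
  by apply/pf_compact_openP; exists a.
Qed.

End spectral_prime_filters.

(** * The dual space of a De Morgan groupoid *)

Section de_morgan_theory.
Context {d : Order.disp_t} {A : deMorganType d}.
Implicit Types a b : A.

Lemma dmneg0 : dmneg \bot = \top :> A.
Proof.
by apply/le_anti; rewrite lex1 -[X in X <= _]dmnegK dmneg_anti ?le0x.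
Qed.

Lemma dmneg1 : dmneg \top = \bot :> A.
Proof. by rewrite -dmneg0 dmnegK. Qed.

Lemma dmnegU a b : dmneg (a `|` b)%O = (dmneg a `&` dmneg b)%O.
Proof.
apply/le_anti; rewrite lexI !dmneg_anti ?leUl ?leUr //=.
(* Antitonicity reduces this half to [a] and [b] lying below the negation of the meet of [dmneg a]
   and [dmneg b]. *)
rewrite -[X in X <= _]dmnegK dmneg_anti // leUx.
by rewrite -{1}[a]dmnegK -{2}[b]dmnegK !dmneg_anti ?leIl ?leIr.
Qed.

Lemma dmnegI a b : dmneg (a `&` b)%O = (dmneg a `|` dmneg b)%O.
Proof. by rewrite -[RHS]dmnegK dmnegU !dmnegK. Qed.

Definition pf_neg_mem (P : prime_filter A) : A -> Prop :=
  fun a => ~ P (dmneg a).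

(** Negation is a dual automorphism of the lattice, so it pulls [P] back to a prime ideal, whose
    complement is a prime filter. *)
Lemma pf_neg_prime P : is_prime_filter (pf_neg_mem P).
Proof.
rewrite /pf_neg_mem; split; first split.
- by rewrite dmneg1; exact: pf0.
- by move=> a b ab; apply: contra_not; apply: pfS; exact: dmneg_anti.
- by move=> a b Pa Pb; rewrite dmnegI => /pfU[].
- by rewrite dmneg0; apply; exact: pfT.
- by move=> a b; rewrite dmnegU => /(contra_not (pfI _ _ _).2)/not_andP.
Qed.

Definition pf_neg P := PrimeFilter (pf_neg_prime P).

Lemma pf_negE P a : pf_neg P a <-> ~ P (dmneg a). Proof. by []. Qed.

Lemma pf_negK : involutive pf_neg.
Proof.
by move=> P; apply: pf_eq => a; rewrite !pf_negE dmnegK not_notE.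
Qed.

Lemma pf_basic_neg a : [set P | ~ pf_basic a (pf_neg P)] = pf_basic (dmneg a).
Proof. by apply/seteqP; split=> P; rewrite /pf_basic /= /pf_neg_mem not_notE. Qed.

Lemma pf_de_morgan_spectral : de_morgan_spectral pf_neg.
Proof.
split; first exact: pf_spectral.
- move=> P Q /pf_specialization PQ; apply/pf_specialization => a.
  by apply: contra_not; exact: PQ.
- exact: pf_negK.
- move=> _ /pf_compact_openP[a ->]; rewrite pf_basic_neg.
  by apply/pf_compact_openP; exists (dmneg a).
Qed.

End de_morgan_theory.

(** * The ternary relation on prime filters *)

Section groupoid_theory.
Context {d : Order.disp_t} {A : dmGroupoidType d}.
Implicit Types (a b c : A) (F G I : set A) (P Q R : prime_filter A).

Lemma le_dmmul a a' b b' : a <= a' -> b <= b' -> dmmul a b <= dmmul a' b'.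
Proof.
move=> /join_idPl <- /join_idPl <-; rewrite dmmulUl !dmmulUr.
exact: le_trans (leUr _ _) (leUr _ _).
Qed.

Definition pf_rel P Q R := forall a b, P a -> Q b -> R (dmmul a b).

(** In the ideal to be avoided, two witnesses from [G] are replaced by their meet; distributivity
    over joins and primeness of [R] then give closure under joins. [G] may be any filter, so that
    the two factors can be enlarged one after the other. *)
Lemma pf_rel_extendl F G R : lattice_filter F -> lattice_filter G ->
  (forall a b, F a -> G b -> R (dmmul a b)) ->
  exists2 P : prime_filter A, F `<=` P &
    forall a b, P a -> G b -> R (dmmul a b).
Proof.
move=> Ff Gf FGR.
have Ii : lattice_ideal [set a | exists2 b, G b & ~ R (dmmul a b)].
  split=> [|a b ab [c Gc] nR|a b [a' Ga' na] [b' Gb' nb]].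
  - by exists \top; [exact: lfilterT|rewrite dmmul0l; exact: pf0].
  - by exists c => //; apply: contra_not nR; apply: pfS; exact: le_dmmul.
  - exists (a' `&` b')%O; first exact: lfilterI.
    rewrite dmmulUl => /pfU[]; [apply: contra_not na|apply: contra_not nb];
      by apply: pfS; apply: le_dmmul; rewrite ?leIl ?leIr.
have [|P [Pp FP PI]] := prime_filter_separation Ff Ii.
  by move=> a Fa [b Gb]; apply; exact: FGR.
exists (PrimeFilter Pp) => // a b Pa Gb; apply: contrapT => nR.
by apply: (PI a) => //; exists b.
Qed.

Lemma pf_rel_extendr F G R : lattice_filter F -> lattice_filter G ->
  (forall a b, F a -> G b -> R (dmmul a b)) ->
  exists2 Q : prime_filter A, G `<=` Q &
    forall a b, F a -> Q b -> R (dmmul a b).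
Proof.
move=> Ff Gf FGR.
have Ii : lattice_ideal [set b | exists2 a, F a & ~ R (dmmul a b)].
  split=> [|a b ab [c Fc] nR|a b [a' Fa' na] [b' Fb' nb]].
  - by exists \top; [exact: lfilterT|rewrite dmmul0r; exact: pf0].
  - by exists c => //; apply: contra_not nR; apply: pfS; exact: le_dmmul.
  - exists (a' `&` b')%O; first exact: lfilterI.
    rewrite dmmulUr => /pfU[]; [apply: contra_not na|apply: contra_not nb];
      by apply: pfS; apply: le_dmmul; rewrite ?leIl ?leIr.
have [|Q [Qp GQ QI]] := prime_filter_separation Gf Ii.
  by move=> b Gb [a Fa]; apply; exact: FGR.
exists (PrimeFilter Qp) => // a b Fa Qb; apply: contrapT => nR.
by apply: (QI b) => //; exists a.
Qed.

Lemma pf_rel_extend F G R : lattice_filter F -> lattice_filter G ->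
  (forall a b, F a -> G b -> R (dmmul a b)) ->
  exists P Q, [/\ pf_rel P Q R, F `<=` P & G `<=` Q].
Proof.
move=> Ff Gf /(pf_rel_extendl Ff Gf)[P FP].
move=> /(pf_rel_extendr (prime_lfilter (pf_prime P)) Gf)[Q GQ PQR].
by exists P, Q.
Qed.

(** The filter generated by the products of [P] and [G] avoids [I]. It is first enlarged to the
    prime filter [R], and only then [G] to [Q] against this [R]. An arbitrary ideal [I] covers both
    later uses: a principal ideal and an ideal generated by an image. *)
Lemma pf_rel_extend_imp P G I : lattice_filter G -> lattice_ideal I ->
  (forall a b, P a -> G b -> ~ I (dmmul a b)) ->
  exists Q R, [/\ pf_rel P Q R, G `<=` Q & forall c, R c -> ~ I c].
Proof.
move=> Gf Ii PGI; have Pf := prime_lfilter (pf_prime P).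
have Hf : lattice_filter
    [set c | exists a b, [/\ P a, G b & dmmul a b <= c]].
  split=> [|c c' cc' [a [b [Pa Gb abc]]]|].
  - by exists \top, \top; split; [exact: pfT|exact: lfilterT|exact: lex1].
  - by exists a, b; split=> //; exact: le_trans cc'.
  - move=> c c' [a [b [Pa Gb abc]]] [a' [b' [Pa' Gb' abc']]].
    exists (a `&` a')%O, (b `&` b')%O; split; [exact/pfI|exact: lfilterI|].
    rewrite lexI (le_trans _ abc) ?(le_trans _ abc') //;
      by apply: le_dmmul; rewrite ?leIl ?leIr.
have [|R [Rp HR RI]] := prime_filter_separation Hf Ii.
  by move=> c [a [b [Pa Gb abc]]] /(lidealS Ii abc); exact: PGI.
have [|Q GQ PQR] := @pf_rel_extendr P G (PrimeFilter Rp) Pf Gf.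
  by move=> a b Pa Gb; apply: HR; exists a, b.
by exists Q, (PrimeFilter Rp).
Qed.

Lemma pf_basic_mul a b :
  rel_mul pf_rel (pf_basic a) (pf_basic b) = pf_basic (dmmul a b).
Proof.
apply/seteqP; split=> R; first by move=> [P [Q [PQR Pa Qb]]]; exact: PQR.
move=> Rab.
have [|P [Q [PQR aP bQ]]] := @pf_rel_extend _ _ R
    (lfilter_principal a) (lfilter_principal b).
  by move=> a' b' aa' bb'; apply: pfS Rab; exact: le_dmmul.
by exists P, Q; split=> //; [apply: aP => /=|apply: bQ => /=].
Qed.

Lemma dmimp_mul a b : dmmul (dmimp a b) a <= b.
Proof. exact/dmmul_residual. Qed.

(** If [P] misses [dmimp a b], residuation keeps the products of [P] with the principal filter of
    [a] out of the principal ideal of [b]; the extension lemma then yields [Q] and [R] that refute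
    membership in [rel_imp]. *)
Lemma pf_basic_imp a b :
  rel_imp pf_rel (pf_basic a) (pf_basic b) = pf_basic (dmimp a b).
Proof.
apply/seteqP; split=> P; last first.
  by move=> Pab Q R [PQR Qa]; apply: pfS (dmimp_mul a b) _; exact: PQR.
move=> Pab; apply: contrapT => nPab.
have [|Q [R [PQR aQ Rb]]] := @pf_rel_extend_imp P _ _
    (lfilter_principal a) (lideal_principal b).
  move=> a' b' Pa' bb' ab'; apply: nPab; apply: pfS Pa'.
  by apply/dmmul_residual; apply: le_trans ab'; exact: le_dmmul.
apply: (Rb b) => //=; apply: (Pab Q R); split=> //.
by apply: aQ => /=.
Qed.

Lemma pf_dmgrp_space : is_dmgrp_space pf_neg pf_rel (pf_basic (dmt : A)).
Proof.
split; first exact: pf_de_morgan_spectral.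
- move=> _ _ /pf_compact_openP[a ->] /pf_compact_openP[b ->].
  by rewrite pf_basic_mul; apply/pf_compact_openP; exists (dmmul a b).
- move=> _ _ /pf_compact_openP[a ->] /pf_compact_openP[b ->].
  by rewrite pf_basic_imp; apply/pf_compact_openP; exists (dmimp a b).
- move=> P Q R P' Q' R' PQR /pf_specialization P'P /pf_specialization Q'Q.
  move=> /pf_specialization RR' a b P'a Q'b.
  by apply: RR'; apply: PQR; [exact: P'P|exact: Q'Q].
- move=> P Q R /existsNP[a /existsNP[b /not_implyP[Pa /not_implyP[Qb Rab]]]].
  exists (pf_basic a), (pf_basic b); split=> //.
  + by apply/pf_compact_openP; exists a.
  + by apply/pf_compact_openP; exists b.
  + by rewrite pf_basic_mul.
- by apply/pf_compact_openP; exists dmt.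
- move=> Q R; rewrite pf_specialization.
  split=> [QR|[P Pt PQR] b Qb]; last first.
    by rewrite -[b]dmmul1l; exact: PQR.
  (* Only the left factor is enlarged, since [Q] must stay. For [a] above [dmt] and [b] in [Q], the
     product of [a] and [b] is above [b], hence in [R]. *)
  have [|P tP PQR] := @pf_rel_extendl _ Q R
      (lfilter_principal dmt) (prime_lfilter (pf_prime Q)).
    by move=> a b ta Qb; apply: pfS (QR _ Qb); rewrite -{1}[b]dmmul1l le_dmmul.
  by exists P => //; apply: tP => /=.
Qed.

Definition dual_space : dmgrp_space := DMGrpSpace pf_dmgrp_space.

End groupoid_theory.

(** * Homomorphisms as morphisms of dual spaces *)

Section dual_maps.
Context {d d' : Order.disp_t} {A : dmGroupoidType d} {B : dmGroupoidType d'}.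
Variable h : dmgrp_hom A B.
Let hP := dmhom_prop h.

Lemma dmhom_le a b : a <= b -> h a <= h b.
Proof. by move=> /join_idPl <-; rewrite (dmhomU hP) leUr. Qed.

Lemma preimage_prime (P : prime_filter B) : is_prime_filter (fun a => P (h a)).
Proof.
split; first split.
- by rewrite (dmhom1 hP); exact: pfT.
- by move=> a b ab; apply: pfS; exact: dmhom_le.
- by move=> a b Pa Pb; rewrite (dmhomI hP); exact/pfI.
- by rewrite (dmhom0 hP); exact: pf0.
- by move=> a b; rewrite (dmhomU hP) => /pfU.
Qed.

Definition dual_fun (P : prime_filter B) : prime_filter A :=
  PrimeFilter (preimage_prime P).

Lemma dual_fun_basic a : dual_fun @^-1` pf_basic a = pf_basic (h a).
Proof. by []. Qed.

Lemma lfilter_image (F : set A) : lattice_filter F ->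
  lattice_filter [set b | exists2 a, F a & h a <= b].
Proof.
move=> Ff; split=> [|b c bc [a Fa ab]|b c [a Fa ab] [a' Fa' ac]].
- by exists \top; [exact: lfilterT|exact: lex1].
- by exists a => //; exact: le_trans bc.
- exists (a `&` a')%O; first exact: lfilterI.
  by rewrite (dmhomI hP) leI2.
Qed.

Lemma lideal_image (I : set A) : lattice_ideal I ->
  lattice_ideal [set b | exists2 a, I a & b <= h a].
Proof.
move=> Ii; split=> [|b c bc [a Ia ca]|b c [a Ia ba] [a' Ia' ca]].
- by exists \bot; [exact: lideal0|exact: le0x].
- by exists a => //; exact: le_trans ca.
- exists (a `|` a')%O; first exact: lidealU.
  by rewrite (dmhomU hP) leU2.
Qed.

Lemma dual_fun_morphism :
  @is_spectral_frame_morphism (@dual_space _ B) (@dual_space _ A) dual_fun.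
Proof.
split=> /=.
- move=> _ /pf_compact_openP[a ->]; rewrite dual_fun_basic.
  by apply/pf_compact_openP; exists (h a).
- by rewrite dual_fun_basic (dmhomt hP).
- by move=> P; apply: pf_eq => a; rewrite /= /pf_neg_mem /= (dmhomN hP).
- by move=> P Q R PQR a b Pa Qb; rewrite /= (dmhomM hP); exact: PQR.
- move=> P' Q' R PQR.
  (* The images of [P'] and [Q'] generate filters of [B] whose products stay in [R], because [h]
     preserves products. *)
  have [|P [Q [PQ P'P Q'Q]]] := @pf_rel_extend _ _ _ _ R
      (lfilter_image (prime_lfilter (pf_prime P')))
      (lfilter_image (prime_lfilter (pf_prime Q'))).
    move=> a b [a' Pa' aa'] [b' Qb' bb'].
    have : R (h (dmmul a' b')) by exact: PQR.
    by apply: pfS; rewrite (dmhomM hP) le_dmmul.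
  exists P, Q; split=> //; apply/pf_specialization => a ?.
  + by apply: P'P; exists a.
  + by apply: Q'Q; exists a.
- move=> P Q' R' PQR.
  (* Avoiding the ideal generated by the image of the complement of [R'] forces [dual_fun R] below
     [R']. Disjointness is where [h] preserving [dmimp] enters: a product below [h c] puts
     [h (dmimp b' c)] in [P], whence [c] is in [R']. *)
  have [|Q [R [PQ Q'Q RR']]] := @pf_rel_extend_imp _ _ P _ _
      (lfilter_image (prime_lfilter (pf_prime Q')))
      (lideal_image (prime_setC_ideal (pf_prime R'))).
    move=> a b Pa [b' Qb' bb'] [c nRc abc]; apply: nRc.
    apply: pfS (dmimp_mul b' c) _; apply: PQR => //=.
    rewrite (dmhom_imp hP); apply: pfS Pa; apply/dmmul_residual.
    by apply: le_trans abc; exact: le_dmmul.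
  exists Q, R; split=> //; apply/pf_specialization => a Qa.
  + by apply: Q'Q; exists a.
  + by apply: contrapT => nRa; apply: (RR' _ Qa); exists a.
Qed.

Definition dual_morphism :
    spectral_frame_morphism (@dual_space _ B) (@dual_space _ A) :=
  SpectralFrameMorphism dual_fun_morphism.

End dual_maps.

(** * The algebra of compact open sets *)

Lemma compact_open0 (X : topologicalType) : compact_open (@set0 X).
Proof. by split; [exact: compact0|exact: open0]. Qed.

Lemma compact_openU (X : topologicalType) (U V : set X) :
  compact_open U -> compact_open V -> compact_open (U `|` V).
Proof. by move=> [cU oU] [cV oV]; split; [exact: compactU|exact: openU]. Qed.

Section space_theory.
Variable X : dmgrp_space.
Let XP := dmsp_prop X.
Let XD := dmsp_spectral XP.
Let XS := dms_spectral XD.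

Lemma dmsp_compact_openT : compact_open [set: X].
Proof. by split; [exact: spectral_compact XS|exact: openT]. Qed.

Lemma dmsp_compact_openI (U V : set X) :
  compact_open U -> compact_open V -> compact_open (U `&` V).
Proof. exact: spectral_setI XS U V. Qed.

Lemma dmsp_nbhs (x : X) (N : set X) : nbhs x N ->
  exists U, [/\ compact_open U, U x & U `<=` N].
Proof. by move=> /(spectral_basis XS).2[U [cU Ux] UN]; exists U. Qed.

Lemma dmsp_star (U : set X) : compact_open U ->
  compact_open [set x | ~ U (dmsp_inv x)].
Proof. exact: dms_star XD U. Qed.

End space_theory.

Record cpt_open (X : dmgrp_space) := CptOpen {
  co_set :> X -> Prop;
  co_prop : compact_open co_set }.

HB.instance Definition _ (X : dmgrp_space) := gen_eqMixin (cpt_open X).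
HB.instance Definition _ (X : dmgrp_space) := gen_choiceMixin (cpt_open X).

Section cpt_open_algebra.
Variable X : dmgrp_space.
Implicit Types U V W : cpt_open X.
Let XP := dmsp_prop X.

Lemma co_eq U V : (forall x, U x <-> V x) -> U = V.
Proof.
move: U V => [U cU] [V cV] /= UV.
have UVE : U = V by apply/funext => x; exact/propext.
by subst V; congr CptOpen; exact: Prop_irrelevance.
Qed.

Definition co_le U V := `[< forall x, U x -> V x >].

Lemma co_le_refl : reflexive co_le.
Proof. by move=> U; apply/asboolP. Qed.

Lemma co_le_anti : antisymmetric co_le.
Proof.
move=> U V /andP[/asboolP UV /asboolP VU].
by apply: co_eq => x; split; [exact: UV|exact: VU].
Qed.

Lemma co_le_trans : transitive co_le.
Proof.
by move=> V U W /asboolP UV /asboolP VW; apply/asboolP => x /UV /VW.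
Qed.

(** The display is the one fixed in [DMGrp], so that [cpt_open X] becomes an object of it. *)
HB.instance Definition _ := Order.Le_isPOrder.Build (Order.Disp tt tt)
  (cpt_open X) co_le_refl co_le_anti co_le_trans.

Lemma co_leP U V : reflect (forall x, U x -> V x) (U <= V).
Proof. exact: asboolP. Qed.

Definition co_meet U V : cpt_open X :=
  CptOpen (dmsp_compact_openI (co_prop U) (co_prop V)).

Definition co_join U V : cpt_open X :=
  CptOpen (compact_openU (co_prop U) (co_prop V)).

Lemma co_meetP U V W : (U <= co_meet V W) = (U <= V) && (U <= W).
Proof.
apply/co_leP/andP => [UVW|[/co_leP UV /co_leP UW] x Ux]; last first.
  by split; [exact: UV|exact: UW].
by split; apply/co_leP => x /UVW[].
Qed.

Lemma co_joinP U V W : (co_join U V <= W) = (U <= W) && (V <= W).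
Proof.
apply/co_leP/andP => [UVW|[/co_leP UW /co_leP VW] x [/UW|/VW]//].
by split; apply/co_leP => x ?; apply: UVW; [left|right].
Qed.

HB.instance Definition _ := Order.POrder_MeetJoin_isLattice.Build
  (Order.Disp tt tt) (cpt_open X) co_meetP co_joinP.

Lemma co_meetUl :
  @left_distributive (cpt_open X) (cpt_open X) Order.meet Order.join.
Proof.
move=> U V W; apply: co_eq => x; split; first by move=> [[?|?] ?]; [left|right].
by move=> [[? ?]|[? ?]]; split=> //; [left|right].
Qed.

HB.instance Definition _ := Order.Lattice_Meet_isDistrLattice.Build
  (Order.Disp tt tt) (cpt_open X) co_meetUl.

Definition co_bot : cpt_open X := CptOpen (compact_open0 X).
Definition co_top : cpt_open X := CptOpen (dmsp_compact_openT X).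

Lemma co_le0x U : co_bot <= U. Proof. by apply/co_leP. Qed.

Lemma co_lex1 U : U <= co_top. Proof. by apply/co_leP. Qed.

HB.instance Definition _ := Order.hasBottom.Build
  (Order.Disp tt tt) (cpt_open X) co_le0x.
HB.instance Definition _ := Order.hasTop.Build
  (Order.Disp tt tt) (cpt_open X) co_lex1.

Definition co_neg U : cpt_open X := CptOpen (dmsp_star (co_prop U)).

Lemma co_neg_anti U V : U <= V -> co_neg V <= co_neg U.
Proof.
by move=> /co_leP UV; apply/co_leP => x; apply: contra_not; exact: UV.
Qed.

Lemma co_negK U : co_neg (co_neg U) = U.
Proof.
by apply: co_eq => x; rewrite /= not_notE (dms_invol (dmsp_spectral XP)).
Qed.

HB.instance Definition _ := TBDistrLattice_isDeMorgan.Build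
  (Order.Disp tt tt) (cpt_open X) co_neg_anti co_negK.

Definition co_mul U V : cpt_open X :=
  CptOpen (dmsp_mul XP (co_prop U) (co_prop V)).

Definition co_imp U V : cpt_open X :=
  CptOpen (dmsp_imp XP (co_prop U) (co_prop V)).

Definition co_t : cpt_open X := CptOpen (dmsp_Theta XP).

(** By the unit axiom, multiplying by [co_t] closes [U] upwards for specialization, and an open set
    is already closed upwards. *)
Lemma co_mul1l U : co_mul co_t U = U.
Proof.
apply: co_eq => z; split=> [[x [y [Sxyz tx Uy]]]|Uz].
  apply: ((dmsp_unit XP y z).2 _ _ (co_prop U).2) => //.
  by exists x.
have [x tx Sxzz] := (dmsp_unit XP z z).1 (@specialization_refl _ z).
by exists x, z.
Qed.

Lemma co_mul0r U : co_mul U \bot = \bot.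
Proof. by apply: co_eq => z; split=> // -[x [y []]]. Qed.

Lemma co_mul0l U : co_mul \bot U = \bot.
Proof. by apply: co_eq => z; split=> // -[x [y []]]. Qed.

Lemma co_mulUr U V W :
  co_mul U (V `|` W)%O = (co_mul U V `|` co_mul U W)%O.
Proof.
apply: co_eq => z; split=> [[x [y [S Ux [Vy|Wy]]]]|[|] [x [y [S Ux Vy]]]].
- by left; exists x, y.
- by right; exists x, y.
- by exists x, y; split=> //; left.
- by exists x, y; split=> //; right.
Qed.

Lemma co_mulUl U V W :
  co_mul (U `|` V)%O W = (co_mul U W `|` co_mul V W)%O.
Proof.
apply: co_eq => z; split=> [[x [y [S [Ux|Vx] Wy]]]|[|] [x [y [S Ux Wy]]]].
- by left; exists x, y.
- by right; exists x, y.
- by exists x, y; split=> //; left.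
- by exists x, y; split=> //; right.
Qed.

Lemma co_mul_residual U V W : co_mul U V <= W <-> U <= co_imp V W.
Proof.
split=> /co_leP UVW; apply/co_leP.
- by move=> x Ux y z [Sxyz Vy]; apply: UVW; exists x, y.
- by move=> z [x [y [Sxyz Ux Vy]]]; exact: (UVW x Ux y z).
Qed.

HB.instance Definition _ := DeMorgan_isDMGroupoid.Build
  (Order.Disp tt tt) (cpt_open X)
  co_mul1l co_mul0r co_mul0l co_mulUr co_mulUl co_mul_residual.

Lemma co_impE U V x : dmimp U V x = rel_imp (@dmsp_rel X) U V x.
Proof. by []. Qed.

End cpt_open_algebra.

(** * Spectral frame morphisms as homomorphisms by preimage *)

Section preimage_homomorphism.
Variables (X Y : dmgrp_space) (f : spectral_frame_morphism X Y).
Let fP := sfm_prop f.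

Definition preimage_co (U : cpt_open Y) : cpt_open X :=
  CptOpen (sfm_spectral fP (co_prop U)).

(** For product and implication, one inclusion is [sfm_rel] and the other is the matching back
    condition. The latter holds only up to specialization, which suffices because open sets are
    closed upwards. *)
Lemma preimage_co_hom : is_dmgrp_hom preimage_co.
Proof.
split.
- by move=> U V; apply: co_eq.
- by move=> U V; apply: co_eq.
- by move=> U; apply: co_eq => x; rewrite /= (sfm_inv fP).
- move=> U V; apply: co_eq => z.
  split=> [[x' [y' [Sfz Ux' Vy']]]|[x [y [Sxyz Ux Vy]]]].
    have [x [y [Sxyz x'x y'y]]] := sfm_back_mul fP Sfz.
    exists x, y; split=> //; first exact: (x'x _ (co_prop U).2).
    exact: (y'y _ (co_prop V).2).
  by exists (f x), (f y); split=> //; exact: sfm_rel.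
- move=> U V; apply: co_eq => x; rewrite co_impE.
  split=> [UVx y z [Sxyz Uy]|UVx].
    by apply: (UVx (f y) (f z)); split=> //; exact: sfm_rel.
  move=> y' z' [/(sfm_back_imp fP)[y [z [S y'y zz']]] Uy'].
  apply: (zz' _ (co_prop V).2); apply: (UVx y z); split=> //.
  exact: (y'y _ (co_prop U).2).
- have /seteqP[XT TX] := sfm_unitset fP.
  by apply: co_eq => x; split; [exact: XT|exact: TX].
- by apply: co_eq.
- by apply: co_eq.
Qed.

Definition preimage_morphism : dmgrp_hom (cpt_open Y) (cpt_open X) :=
  DMGrpHom preimage_co_hom.

End preimage_homomorphism.

(** * The Stone map as an isomorphism of De Morgan groupoids *)

Section cpt_open_dual.
Context {d : Order.disp_t} {A : dmGroupoidType d}.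

Lemma pf_basic_compact_open (a : A) : compact_open (pf_basic a).
Proof. by apply/pf_compact_openP; exists a. Qed.

Definition co_basic (a : A) : cpt_open (@dual_space _ A) :=
  @CptOpen (dual_space) _ (pf_basic_compact_open a).

Lemma co_basic_inj : injective co_basic.
Proof.
by move=> a b /(congr1 (@co_set _)) /pf_basic_inj.
Qed.

Lemma co_basic_surj (U : cpt_open (@dual_space _ A)) :
  exists a, co_basic a = U.
Proof.
have [a Ua] := (pf_compact_openP U).1 (co_prop U).
by exists a; apply: co_eq => P; rewrite Ua.
Qed.

Lemma co_basic_hom : is_dmgrp_hom co_basic.
Proof.
split.
- by move=> a b; apply: co_eq => P; exact: pfI.
- by move=> a b; apply: co_eq => P; exact: pfU.
- by move=> a; apply: co_eq => P; rewrite /= /pf_neg_mem not_notE.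
- by move=> a b; apply: co_eq => P; rewrite /= pf_basic_mul.
- by move=> a b; apply: co_eq => P; rewrite /= pf_basic_imp.
- exact: co_eq.
- by apply: co_eq => P; split=> // /pf0.
- by apply: co_eq => P; split=> // _; exact: pfT.
Qed.

End cpt_open_dual.

Lemma dmgrp_hom_inverse d d' (A : dmGroupoidType d) (B : dmGroupoidType d')
    (f : A -> B) (g : B -> A) :
  is_dmgrp_hom f -> cancel f g -> cancel g f -> is_dmgrp_hom g.
Proof.
move=> fP fK gK; split=> *; apply: (can_inj fK).
- by rewrite (dmhomI fP) !gK.
- by rewrite (dmhomU fP) !gK.
- by rewrite (dmhomN fP) !gK.
- by rewrite (dmhomM fP) !gK.
- by rewrite (dmhom_imp fP) !gK.
- by rewrite (dmhomt fP) !gK.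
- by rewrite (dmhom0 fP) !gK.
- by rewrite (dmhom1 fP) !gK.
Qed.

(** The roles of the conditions are exchanged: [g] preserves the relation by a back condition of
    [f], and the back conditions of [g] come from [f] preserving the relation. *)
Lemma sfm_inverse (X Y : dmgrp_space) (f : X -> Y) (g : Y -> X) :
  is_spectral_frame_morphism f -> spectral_map g ->
  cancel f g -> cancel g f -> is_spectral_frame_morphism g.
Proof.
move=> fP gS fK gK.
have gle (x y : Y) : specialization x y -> specialization (g x) (g y).
  have XB := spectral_basis (dms_spectral (dmsp_spectral (dmsp_prop X))).
  exact: (spectral_map_homo XB gS).
split=> //.
- rewrite -(sfm_unitset fP) -comp_preimage.
  by apply/seteqP; split=> y /=; rewrite gK.
- by move=> y; rewrite -{1}[y]gK -(sfm_inv fP) fK.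
(* The back condition only gives [x] and [y] above [g x'] and [g y']; [dmsp_mono] then brings the
   triple down. *)
- move=> x' y' z'; rewrite -{1}[z']gK.
  move=> /(sfm_back_mul fP)[x [y [Sxyz x'x y'y]]].
  apply: dmsp_mono (dmsp_prop X) _ _ _ _ _ _ Sxyz _ _ _ => //.
    by rewrite -[x]fK; exact: gle.
  by rewrite -[y]fK; exact: gle.
- move=> x y z /(sfm_rel fP); rewrite gK => Sxyz.
  by exists (f x), (f y); rewrite !fK; split=> //; exact: specialization_refl.
- move=> x y z /(sfm_rel fP); rewrite gK => Sxyz.
  by exists (f y), (f z); rewrite !fK; split=> //; exact: specialization_refl.
Qed.

(** * Points as prime filters of compact open sets *)

Section point_filter.
Variable X : dmgrp_space.
Let XP := dmsp_prop X.
Let XD := dmsp_spectral XP.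
Let XS := dms_spectral XD.

Lemma point_filter_prime (x : X) :
  is_prime_filter (fun U : cpt_open X => U x).
Proof. by split=> //; split=> // U V /co_leP UV /UV. Qed.

Definition point_filter (x : X) : @dual_space _ (cpt_open X) :=
  PrimeFilter (point_filter_prime x).

(** The neighbourhood that separates two points in a T0 space shrinks to a compact open one, which
    tells their filters apart. *)
Lemma point_filter_inj : injective point_filter.
Proof.
move=> x y xy; apply/eqP; apply: contrapT => /negP /(spectral_T0 XS)[N].
have key (a b : X) :
    point_filter a = point_filter b -> nbhs a N -> ~ N b -> False.
  move=> ab /dmsp_nbhs[U [cU Ua UN]] nNb; apply: nNb; apply: UN.
  have : point_filter a (CptOpen cU) by [].
  by rewrite ab.
rewrite !inE => -[] [Na Nb]; first exact: (key x y).
exact: (key y x).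
Qed.

(* The opens including a member of [P] form a completely prime filter. Let [V] in
   [P] be covered by [G]. The sets [V `\` W] with [W] not in [P] generate a proper
   filter, which clusters at some [x] in [V]; every compact open neighbourhood of
   [x] is then in [P], and some member of [G] includes one. *)
Lemma point_filter_surj (P : @dual_space _ (cpt_open X)) :
  exists x, point_filter x = P.
Proof.
pose F := [set U : set X | open U /\ exists2 V : cpt_open X, P V & V `<=` U].
have [|x FE] := spectral_sober XS (F := F).
  split.
  - by move=> U [].
  - split; first exact: openT.
    by exists \top; first exact: pfT.
  - move=> U V [oU [U' PU' U'U]] [oV [V' PV' V'V]]; split; first exact: openI.
    by exists (U' `&` V')%O; [exact/pfI|move=> x [/U'U ? /V'V]].
  - move=> U V oV UV [_ [W PW WU]]; split=> //.
    by exists W => //; exact: subset_trans UV.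
  - move=> G Go [_ [V PV VG]]; apply: contrapT => nG.
    pose H := filter_from (fun W : cpt_open X => ~ P W) (fun W => V `\` W).
    have HF : ProperFilter H.
      apply: filter_from_proper.
        apply: filter_from_filter; first by exists \bot; exact: pf0.
        move=> W W' nW nW'; exists (W `|` W')%O; first by move=> /pfU[].
        move=> x [Vx nx]; split; split=> //; apply: contra_not nx => ?.
          by left.
        by right.
      move=> W nW; apply: contrapT => VW; apply: nW; apply: pfS PV.
      apply/co_leP => x Vx; apply: contrapT => nWx.
      by apply: VW; exists x.
    have HV : H V by exists \bot; [exact: pf0|exact: subDsetl].
    have [x [Vx clx]] := (co_prop V).1 H HF HV.
    have [U GU Ux] := VG _ Vx.
    have [W [cW Wx WU]] := dmsp_nbhs (open_nbhs_nbhs (conj (Go _ GU) Ux)).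
    have [PW|nPW] := pselect (P (CptOpen cW)).
      by apply: nG; exists U => //; split; [exact: Go|exists (CptOpen cW)].
    have HW : H (V `\` W) by exists (CptOpen cW).
    have [y [[_ ?] ?]] := clx _ _ HW (open_nbhs_nbhs (conj cW.2 Wx)).
    by [].
(* A compact open [U] containing [x] is in [F], so it includes a member of [P] and is itself in
   [P]. *)
exists x; apply: pf_eq => U; split=> [Ux|PU].
  have [_ [V PV VU]] : F U by rewrite FE; split=> //; exact: (co_prop U).2.
  by apply: pfS PV; apply/co_leP.
have : F U by split; [exact: (co_prop U).2|exists U].
by rewrite FE => -[].
Qed.

Lemma point_filter_basic (U : cpt_open X) :
  point_filter @^-1` pf_basic U = U.
Proof. by []. Qed.

(** This is the separation axiom [dmsp_sep], contraposed: the products of compact open sets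
    determine the relation. *)
Lemma point_filter_rel (x y z : X) :
  pf_rel (point_filter x) (point_filter y) (point_filter z) -> dmsp_rel x y z.
Proof.
move=> xyz; apply: contrapT => /(dmsp_sep XP)[U [V [cU cV Ux Vy]]].
by apply; exact: (xyz (CptOpen cU) (CptOpen cV)).
Qed.

(** By surjectivity the prime filters in the back conditions come from points, and
    [point_filter_rel] reflects the relation to those points. *)
Lemma point_filter_morphism : is_spectral_frame_morphism point_filter.
Proof.
split=> //.
- move=> _ /pf_compact_openP[U ->]; rewrite point_filter_basic.
  exact: co_prop.
- by move=> x; apply: pf_eq => U; rewrite /= /pf_neg_mem /= not_notE.
- by move=> x y z Sxyz U V Ux Vy; exists x, y.
- move=> P Q z; have [x <-] := point_filter_surj P.
  have [y <-] := point_filter_surj Q => /point_filter_rel.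
  by exists x, y; split=> //; exact: specialization_refl.
- move=> x P Q; have [y <-] := point_filter_surj P.
  have [z <-] := point_filter_surj Q => /point_filter_rel.
  by exists y, z; split=> //; exact: specialization_refl.
Qed.

End point_filter.

(** * The equivalence *)

Section inverse_of_bijection.
Variables (T T' : Type) (f : T -> T').
Hypotheses (f_inj : injective f) (f_surj : forall y, exists x, f x = y).

Definition bij_inv (y : T') : T := sval (cid (f_surj y)).

Lemma bij_invK : cancel bij_inv f.
Proof. by move=> y; rewrite /bij_inv; case: cid. Qed.

Lemma bij_invVK : cancel f bij_inv.
Proof. by move=> x; apply: f_inj; rewrite bij_invK. Qed.

End inverse_of_bijection.

(** Transparent, since the components of the natural isomorphisms typecheck only after the object
    map is unfolded. *)
Definition dual_space_functor : functor DMGrp (op_category DMGrpSpec).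
Proof.
refine (@Functor DMGrp (op_category DMGrpSpec)
  (fun A => @dual_space _ A) (fun A B h => dual_morphism h) _ _).
- by move=> A; apply: sfm_eq => P; exact: pf_eq.
- by move=> A B C h k; apply: sfm_eq => P; exact: pf_eq.
Defined.

Definition cpt_open_functor : functor (op_category DMGrpSpec) DMGrp.
Proof.
refine (@Functor (op_category DMGrpSpec) DMGrp
  (fun X => cpt_open X) (fun X Y f => preimage_morphism f) _ _).
- by move=> X; apply: dmgrp_hom_eq => U; exact: co_eq.
- by move=> X Y Z f k; apply: dmgrp_hom_eq => U; exact: co_eq.
Defined.

Section unit_counit.

Let co_basicK (A : DMGrp) := bij_invK (@co_basic_surj _ A).
Let co_basicVK (A : DMGrp) :=
  bij_invVK (@co_basic_inj _ A) (@co_basic_surj _ A).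

Definition co_basic_morphism (A : DMGrp) :
    @hom DMGrp A (cpt_open (@dual_space _ A)) :=
  DMGrpHom (@co_basic_hom _ A).

Definition co_basic_inverse (A : DMGrp) :
    @hom DMGrp (cpt_open (@dual_space _ A)) A :=
  DMGrpHom
    (dmgrp_hom_inverse (@co_basic_hom _ A) (@co_basicVK A) (@co_basicK A)).

Lemma cpt_open_dual_space_iso :
  inhabited (nat_iso (compF cpt_open_functor dual_space_functor) (idF DMGrp)).
Proof.
constructor.
apply: (@NatIso _ _ (compF cpt_open_functor dual_space_functor) (idF DMGrp)
  co_basic_inverse co_basic_morphism).
- by move=> A; apply: dmgrp_hom_eq => U; exact: co_basicK.
- by move=> A; apply: dmgrp_hom_eq => a; exact: co_basicVK.
(* The components are inverses obtained by choice, so naturality is checked after applying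
   [co_basic]; once [U] is written as a basic set, both sides agree by computation. *)
- move=> A B h; apply: dmgrp_hom_eq => U; apply: (@co_basic_inj _ B).
  rewrite /= co_basicK; apply: co_eq => P.
  by rewrite -{1}[U]co_basicK.
Qed.

Let pointK (X : DMGrpSpec) := bij_invK (@point_filter_surj X).
Let pointVK (X : DMGrpSpec) :=
  bij_invVK (@point_filter_inj X) (@point_filter_surj X).

(** The preimage of a compact open [U] under the inverse is the basic set of [U]. *)
Lemma point_inverse_spectral (X : dmgrp_space) :
  spectral_map (bij_inv (@point_filter_surj X)).
Proof.
move=> U cU; apply/pf_compact_openP; exists (CptOpen cU).
by apply/seteqP; split=> P; have [x <-] := point_filter_surj P;
  rewrite /preimage /= pointVK.
Qed.

Definition point_morphism (X : dmgrp_space) :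
    spectral_frame_morphism X (@dual_space _ (cpt_open X)) :=
  SpectralFrameMorphism (point_filter_morphism X).

Definition point_inverse (X : dmgrp_space) :
    spectral_frame_morphism (@dual_space _ (cpt_open X)) X :=
  SpectralFrameMorphism (sfm_inverse (point_filter_morphism X)
    (@point_inverse_spectral X) (@pointVK X) (@pointK X)).

Lemma dual_space_cpt_open_iso :
  inhabited (nat_iso (compF dual_space_functor cpt_open_functor)
    (idF (op_category DMGrpSpec))).
Proof.
constructor.
(* In the opposite category an arrow into [X] is a morphism out of [X], so here [point_morphism] is
   the forward component. *)
apply: (@NatIso _ _ (compF dual_space_functor cpt_open_functor)
  (idF (op_category DMGrpSpec)) point_morphism point_inverse).
- by move=> X; apply: sfm_eq => P; exact: pointK.
- by move=> X; apply: sfm_eq => x; exact: pointVK.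
- by move=> X Y f; apply: sfm_eq => x; exact: pf_eq.
Qed.

End unit_counit.

Theorem theorem4p23 : dually_equivalent DMGrp DMGrpSpec.
Proof.
exists dual_space_functor, cpt_open_functor.
by split; [exact: cpt_open_dual_space_iso|exact: dual_space_cpt_open_iso].
Qed.
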